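(* Let $I$ be a set. The contravariant functors $\mathcal{A}_F=\langle\mathcal{A}_0,\mathcal{A}_1\rangle\colon\mathcal{CUVO}\to\mathcal{COL}$ and $\mathcal{S}_F=\langle\mathcal{S}_0,\mathcal{S}_1\rangle\colon\mathcal{COL}\to\mathcal{CUVO}$ constitute a dual equivalence between the categories $\mathcal{COL}$ and $\mathcal{CUVO}$.
   Context: Algebras. An ortholattice is a bounded lattice $\langle A;\wedge,\vee,0,1\rangle$ with a unary operation ${}^{\perp}$ such that $a\wedge a^{\perp}=0$, $a\vee a^{\perp}=1$, $a\le b\Rightarrow b^{\perp}\le a^{\perp}$, and $a^{\perp\perp}=a$. A quantifier on an ortholattice $A$ is a map $\exists\colon A\to A$ with $\exists(a\vee b)=\exists a\vee\exists b$, $\exists 0=0$, $\exists\exists a=\exists a$, $a\le\exists a$, $\exists(\exists a)^{\perp}=(\exists a)^{\perp}$. An $I$-dimensional cylindric ortholattice is an ortholattice $A$ with unary operators $(\exists_i)_{i\in I}$ and constants $(\delta_{i,k})_{i,k\in I}$ such that for all $i,k,l\in I$: (1) $\exists_i$ is a quantifier; (2) $\exists_i\exists_k a=\exists_k\exists_i a$ for all $a\in A$; (3) $\delta_{i,k}=\delta_{k,i}$ and $\delta_{i,i}=1$; (4) if $i\neq k$ and $l\ne k$, then $\exists_k(\delta_{i,k}\wedge\delta_{k,l})=\delta_{i,l}$. A homomorphism is a bounded lattice homomorphism preserving ${}^\perp$, every $\exists_i$ and every $\delta_{i,k}$. $\mathcal{COL}$ is the category of $I$-dimensional cylindric ortholattices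 and homomorphisms. Frames. For a binary relation $R$ on $X$ and $U\subseteq X$, $R[U]=\{y:xRy\text{ for some }x\in U\}$. An orthoframe is a set $X$ with an irreflexive symmetric relation $\perp$; for $U\subseteq X$, $U^{\perp}=\{x:x\perp y\text{ for all }y\in U\}$, and $\mathcal{B}(X)=\{U\subseteq X:U=U^{\perp\perp}\}$. A monadic orthoframe $\langle X;\perp,R\rangle$ is an orthoframe with a reflexive transitive relation $R$ such that $R[R[\{x\}]^{\perp}]\subseteq R[\{x\}]^{\perp}$ for all $x\in X$. An $I$-dimensional cylindric orthoframe is $\langle X;\perp,(R_i)_{i\in I},(\Delta_{i,k})_{i,k\in I}\rangle$ such that for all $i,k,l\in I$: $\langle X;\perp,R_i\rangle$ is a monadic orthoframe; $R_i\circ R_k=R_k\circ R_i$; $\Delta_{i,k}\subseteq X$ with $\Delta_{i,k}=\Delta_{k,i}=\Delta_{i,k}^{\perp\perp}$ and $\Delta_{i,i}=X$; if $i\ne k$ and $l\neq k$, then $R_k[\Delta_{i,k}\cap\Delta_{k,l}]=\Delta_{i,l}$. For $U,V\in\mathcal{B}(X)$: $U\sqcup V=(U\cup V)^{\perp\perp}$ and $\exists_RU=R[U]^{\perp\perp}$. Spaces. For a topological orthoframe $X$, $\mathcal{CO}(X)$ is the set of compact open subsets, $\mathcal{COB}(X)=\mathcal{CO}(X)\cap\mathcal{B}(X)$, and $\mathcal{COB}_X(x)=\{U\in\mathcal{COB}(X):x\in U\}$. A monadic UVO-space $\langle X;\perp,R,\tau\rangle$ satisfies: (1) $\langle X;\perp,R\rangle$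 is a monadic orthoframe over a $T_0$-space; (2) $\mathcal{COB}(X)$ is a basis for $X$ and is closed under $\cap$ and ${}^{\perp}$; (3) every proper filter in $\mathcal{COB}(X)$ is of the form $\mathcal{COB}_X(x)$ for some $x\in X$; (4) if $x\perp y$, there is $U\in\mathcal{COB}(X)$ with $x\in U$ and $y\in U^{\perp}$; (5) $R[U]\in\mathcal{COB}(X)$ for $U\in\mathcal{COB}(X)$; (6) if not $xRy$, there is $U\in\mathcal{COB}(X)$ with $U=\exists_RV$ for some $V\in\mathcal{COB}_X(x)$ and $y\notin U$. Filters are non-empty. An $I$-dimensional cylindric UVO-space is $\langle X;\perp,(R_i)_{i\in I},(\Delta_{i,k})_{i,k\in I},\tau\rangle$ whose relational part is an $I$-dimensional cylindric orthoframe, such that $\langle X;\perp,R_i,\tau\rangle$ is a monadic UVO-space for each $i$, and $\Delta_{i,k}\in\mathcal{CO}(X)$ for all $i,k\in I$. Maps. The specialization order is: $x\leqslant y$ iff every open set containing $x$ contains $y$. An $I$-dimensional cylindric UVO-map $f\colon X\to X'$ between $I$-dimensional cylindric UVO-spaces satisfies, for all $i,k\in I$: (1) $f$ is spectral, i.e. $f^{-1}[U]\in\mathcal{CO}(X)$ for all $U\in\mathcal{CO}(X')$; (2) if $x\not\perp y$ then $f(x)\not\perp f(y)$; (3) if $z\not\perp f(y)$, there is $x\in X$ with $x\not\perp y$ and $z\leqslant f(x)$; (4) $R_i[f^{-1}[U]]=f^{-1}[R'_i[U]]$ for all $U\in\mathcal{COB}(X')$; (5) $f^{-1}[\Delta'_{i,k}]=\Delta_{i,k}$.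 $\mathcal{CUVO}$ is the category of $I$-dimensional cylindric UVO-spaces and $I$-dimensional cylindric UVO-maps. Functors. $\mathcal{A}_0(X)=\langle\mathcal{COB}(X);\cap,\sqcup,{}^{\perp},\emptyset,X,(\exists_{R_i})_{i\in I},(\Delta_{i,k})_{i,k\in I}\rangle$ and $\mathcal{A}_1(f)=f^{-1}$. $\mathcal{S}_0(A)=\langle\mathfrak{F}(A);\perp,(R_i)_{i\in I},(\Delta_{i,k})_{i,k\in I},\tau(\beta)\rangle$, where $\mathfrak{F}(A)$ is the set of non-empty proper filters of $A$; $x\perp y$ iff there is $a\in x$ with $a^{\perp}\in y$; $xR_iy$ iff $\{\exists_ia:a\in x\}\subseteq y$; $\Delta_{i,k}=\phi(\delta_{i,k})$; and $\tau(\beta)$ is the topology with basis $\{\phi(a):a\in A\}$, $\phi(a)=\{x\in\mathfrak{F}(A):a\in x\}$. $\mathcal{S}_1(h)=h^{-1}$ (i.e. $x\mapsto h^{-1}[x]$). *)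

(* Defs.v *)
From HB Require Import structures.
From mathcomp Require Import all_boot all_order.
From mathcomp Require Import boolp classical_sets functions filter.
From mathcomp Require Import topology_structure compact separation_axioms.

Set Implicit Arguments.
Unset Strict Implicit.
Unset Printing Implicit Defensive.

Import Order.TTheory.

Local Open Scope classical_set_scope.

Record category := Category {
  obj :> Type;
  hom : obj -> obj -> Type;
  idm : forall X, hom X X;
  comp : forall X Y Z, hom Y Z -> hom X Y -> hom X Z;
  comp_idl : forall X Y (f : hom X Y), comp (idm Y) f = f;
  comp_idr : forall X Y (f : hom X Y), comp f (idm X) = f;
  comp_assoc : forall W X Y Z (h : hom Y Z) (g : hom X Y) (f : hom W X),
    comp h (comp g f) = comp (comp h g) f }.

Arguments idm {c} X.
Arguments comp {c X Y Z} g f.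

Definition is_iso (C : category) (X Y : C) (f : hom X Y) : Prop :=
  exists g : hom Y X, comp g f = idm X /\ comp f g = idm Y.

Record cofunctor_data (C D : category) := CofunctorData {
  fobj :> C -> D;
  fmor : forall X Y : C, hom X Y -> hom (fobj Y) (fobj X) }.

Arguments fmor {C D} c {X Y} f.

Definition is_cofunctor (C D : category) (F : cofunctor_data C D) : Prop :=
  (forall X : C, fmor F (idm X) = idm (F X)) /\
  (forall (X Y Z : C) (g : hom Y Z) (f : hom X Y),
     fmor F (comp g f) = comp (fmor F f) (fmor F g)).

Definition natural_iso_id (C D : category)
    (F : cofunctor_data C D) (G : cofunctor_data D C) : Prop :=
  exists eta : forall X : C, hom X (G (F X)),
    (forall X, is_iso (eta X)) /\
    (forall (X Y : C) (f : hom X Y),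
       comp (eta Y) f = comp (fmor G (fmor F f)) (eta X)).

Definition dual_equivalence (C D : category)
    (F : cofunctor_data C D) (G : cofunctor_data D C) : Prop :=
  [/\ is_cofunctor F, is_cofunctor G, natural_iso_id F G & natural_iso_id G F].

(* The signature alone; the axioms are in [is_col]. *)
Record cylAlg (I : Type) := CylAlg {
  alg_disp : Order.disp_t;
  alg_lattice :> tbLatticeType alg_disp;
  orth : alg_lattice -> alg_lattice;
  cyl : I -> alg_lattice -> alg_lattice;
  diag : I -> I -> alg_lattice }.

Arguments orth {I c} a.
Arguments cyl {I c} i a.
Arguments diag {I c} i k.

Definition is_ortholattice d (L : tbLatticeType d) (o : L -> L) : Prop :=
  [/\ forall a, (a `&` o a)%O = \bot%O,
      forall a, (a `|` o a)%O = \top%O,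
      forall a b, (a <= b)%O -> (o b <= o a)%O
    & forall a, o (o a) = a].

Definition is_quantifier d (L : tbLatticeType d) (o e : L -> L) : Prop :=
  [/\ forall a b, e (a `|` b)%O = (e a `|` e b)%O,
      e \bot%O = \bot%O,
      forall a, e (e a) = e a,
      forall a, (a <= e a)%O
    & forall a, e (o (e a)) = o (e a)].

Definition is_col (I : Type) (A : cylAlg I) : Prop :=
  is_ortholattice (@orth I A) /\
  [/\ forall i, is_quantifier (@orth I A) (cyl i),
      forall i k (a : A), cyl i (cyl k a) = cyl k (cyl i a),
      (forall i k, diag i k = diag k i :> A) /\
      (forall i, diag i i = \top%O :> A)
    & forall i k l, i <> k -> l <> k ->
        cyl k (diag i k `&` diag k l)%O = diag i l :> A].

Definition is_col_hom (I : Type) (A B : cylAlg I) (h : A -> B) : Prop :=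
  [/\ {morph h : a b / (a `&` b)%O} /\ {morph h : a b / (a `|` b)%O},
      h \bot%O = \bot%O /\ h \top%O = \top%O,
      {morph h : a / orth a},
      forall i, {morph h : a / cyl i a}
    & forall i k, h (diag i k) = diag i k].

Record col (I : Type) := Col { col_alg :> cylAlg I; colP : is_col col_alg }.

Record col_hom (I : Type) (A B : col I) := ColHom {
  col_fun :> A -> B;
  col_homP : is_col_hom col_fun }.

Lemma col_hom_eq (I : Type) (A B : col I) (f g : col_hom A B) :
  (forall a, f a = g a) -> f = g.
Proof.
case: f g => [f fP] [g gP] /= /funext fg; rewrite {}fg in fP *.
by rewrite (Prop_irrelevance fP gP).
Qed.

Lemma col_id_subproof (I : Type) (A : col I) : is_col_hom (fun a : A => a).
Proof. by []. Qed.

Lemma col_comp_subproof (I : Type) (A B C : col I)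
  (g : col_hom B C) (f : col_hom A B) : is_col_hom (fun a => g (f a)).
Proof.
case: g f => [g [[gI gU] [g0 g1] go gc gd]] [f [[fI fU] [f0 f1] fo fc fd]] /=.
split.
- by split=> a b; rewrite ?(fI, fU) ?(gI, gU).
- by rewrite f0 f1.
- by move=> a; rewrite fo go.
- by move=> i a; rewrite fc gc.
- by move=> i k; rewrite fd gd.
Qed.

Program Definition COL (I : Type) : category := {|
  obj := col I;
  hom := @col_hom I;
  idm A := ColHom (@col_id_subproof I A);
  comp A B C g f := ColHom (col_comp_subproof g f) |}.
Next Obligation. by move=> *; exact: col_hom_eq. Qed.
Next Obligation. by move=> *; exact: col_hom_eq. Qed.
Next Obligation. by move=> *; exact: col_hom_eq. Qed.

Section Orthoframes.
Context {X : Type}.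
Implicit Types (perp R S : X -> X -> Prop) (U V : set X).

Definition rimage R U : set X := [set y | exists2 x, U x & R x y].

Definition rcomp R S : X -> X -> Prop := fun x z => exists2 y, R x y & S y z.

Definition polar perp U : set X := [set x | forall y, U y -> perp x y].

(* [biortho perp] is the set B(X). *)
Definition biortho perp : set (set X) :=
  [set U | U = polar perp (polar perp U)].

Definition bijoin perp U V : set X := polar perp (polar perp (U `|` V)).

Definition bicyl perp R U : set X := polar perp (polar perp (rimage R U)).

Definition is_orthoframe perp : Prop :=
  (forall x, ~ perp x x) /\ (forall x y, perp x y -> perp y x).

Definition is_monadic_orthoframe perp R : Prop :=
  [/\ is_orthoframe perp,
      forall x, R x x,
      forall x y z, R x y -> R y z -> R x z
    & forall x, rimage R (polar perp (rimage R [set x]))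
                  `<=` polar perp (rimage R [set x])].

(* Orthoframe-ness is repeated outside the quantification over [i] so that it
   is still required when [I] is empty. *)
Definition is_cyl_orthoframe (I : Type) perp (R : I -> X -> X -> Prop)
    (D : I -> I -> set X) : Prop :=
  is_orthoframe perp /\
  [/\ forall i, is_monadic_orthoframe perp (R i),
      forall i k, rcomp (R i) (R k) = rcomp (R k) (R i),
      [/\ forall i k, D i k = D k i,
          forall i k, D i k = polar perp (polar perp (D i k))
        & forall i, D i i = setT]
    & forall i k l, i <> k -> l <> k ->
        rimage (R k) (D i k `&` D k l) = D i l].

End Orthoframes.

Section OrthoframeFacts.
Context {X : Type} {perp : X -> X -> Prop}.
Hypothesis perpP : is_orthoframe perp.
Implicit Types U V : set X.
Local Notation "U ^!" := (polar perp U) (at level 2, format "U ^!").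

Lemma polarS U V : U `<=` V -> V^! `<=` U^!.
Proof. by move=> UV x xV y /UV /xV. Qed.

Lemma sub_polar2 U : U `<=` U^!^!.
Proof. by move=> x Ux y /(_ _ Ux); exact: perpP.2. Qed.

Lemma polar3 U : U^!^!^! = U^!.
Proof.
by apply/seteqP; split; [apply/polarS/sub_polar2 | exact: sub_polar2].
Qed.

Lemma polar0 : (set0 : set X)^! = setT.
Proof. by apply/seteqP; split=> x // _ y []. Qed.

Lemma polarT : [set: X]^! = set0.
Proof. by apply/seteqP; split=> x // /(_ x I) /perpP.1. Qed.

Lemma polarU U V : (U `|` V)^! = U^! `&` V^!.
Proof.
apply/seteqP; split=> x; last by move=> [xU xV] y [/xU|/xV].
by move=> xUV; split=> y ?; apply: xUV; [left|right].
Qed.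

End OrthoframeFacts.

Section Spaces.
Context {X : topologicalType}.
Implicit Types (perp R : X -> X -> Prop).

Definition CO : set (set X) := [set U | compact U /\ open U].

Definition COB perp : set (set X) := CO `&` biortho perp.

Definition COB_at perp (x : X) : set (set X) := [set U | COB perp U /\ U x].

Definition spec_le (x y : X) : Prop := forall U : set X, open U -> U x -> U y.

(* Proper filters of a collection [B] of sets ordered by inclusion and closed
   under binary intersections. *)
Definition is_proper_set_filter (B F : set (set X)) : Prop :=
  [/\ F `<=` B, F !=set0,
      forall U V, F U -> B V -> U `<=` V -> F V,
      forall U V, F U -> F V -> F (U `&` V)
    & F <> B].

(* The part of the definition of a monadic UVO-space that does not involve its
   relation [R]. *)
Definition is_UVO perp : Prop :=
  (is_orthoframe perp /\ kolmogorov_space X) /\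
  [/\ basis (COB perp),
      forall U V, COB perp U -> COB perp V -> COB perp (U `&` V),
      forall U, COB perp U -> COB perp (polar perp U),
      forall F, is_proper_set_filter (COB perp) F -> exists x, F = COB_at perp x
    & forall x y, perp x y -> exists U, [/\ COB perp U, U x & polar perp U y]].

Definition is_monadic_UVO perp R : Prop :=
  [/\ is_monadic_orthoframe perp R,
      is_UVO perp,
      forall U, COB perp U -> COB perp (rimage R U)
    & forall x y, ~ R x y ->
        exists U, [/\ COB perp U,
                      exists2 V, COB_at perp x V & U = bicyl perp R V
                    & ~ U y]].

End Spaces.

(* The signature alone; the axioms are in [is_cuvo]. *)
Record cylFrame (I : Type) := CylFrame {
  frame_space :> topologicalType;
  perp : frame_space -> frame_space -> Prop;
  acc : I -> frame_space -> frame_space -> Prop;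
  Diag : I -> I -> set frame_space }.

Arguments perp {I c} x y.
Arguments acc {I c} i x y.
Arguments Diag {I c} i k.

(* [is_UVO] follows from [is_monadic_UVO] as soon as [I] is inhabited; it is
   stated separately so that it is still required when [I] is empty, in which
   case the quantification over [i] puts no condition on the space. *)
Definition is_cuvo (I : Type) (X : cylFrame I) : Prop :=
  [/\ is_UVO (@perp I X),
      is_cyl_orthoframe (@perp I X) acc Diag,
      forall i, is_monadic_UVO (@perp I X) (acc i)
    & forall i k, CO (@Diag I X i k)].

Definition is_cuvo_map (I : Type) (X Y : cylFrame I) (f : X -> Y) : Prop :=
  [/\ forall U, CO U -> CO (f @^-1` U),
      forall x y, ~ perp x y -> ~ perp (f x) (f y),
      forall (y : X) (z : Y), ~ perp z (f y) ->
        exists2 x, ~ perp x y & spec_le z (f x),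
      forall i U, COB perp U ->
        rimage (acc i) (f @^-1` U) = f @^-1` (rimage (acc i) U)
    & forall i k, f @^-1` (Diag i k) = Diag i k].

Record cuvo (I : Type) := Cuvo {
  cuvo_frame :> cylFrame I;
  cuvoP : is_cuvo cuvo_frame }.

Record cuvo_map (I : Type) (X Y : cuvo I) := CuvoMap {
  cuvo_fun :> X -> Y;
  cuvo_mapP : is_cuvo_map cuvo_fun }.

Section CuvoFacts.
Context {I : Type} {X : cuvo I}.

Lemma cuvo_UVO : is_UVO (@perp I X).
Proof. by have [] := cuvoP X. Qed.

Lemma cuvo_orthoframe : is_orthoframe (@perp I X).
Proof. by have [[]] := cuvo_UVO. Qed.

Lemma COB_setI (U V : set X) : COB perp U -> COB perp V -> COB perp (U `&` V).
Proof. by have [_ [_ + _ _ _]] := cuvo_UVO; apply. Qed.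

Lemma COB_polar (U : set X) : COB perp U -> COB perp (polar perp U).
Proof. by have [_ [_ _ + _ _]] := cuvo_UVO; apply. Qed.

Lemma COB_set0 : COB perp (set0 : set X).
Proof.
split; first by split; [exact: compact0 | exact: open0].
by rewrite /biortho /= polar0 (polarT cuvo_orthoframe).
Qed.

Lemma COB_setT : COB perp [set: X].
Proof. by rewrite -(@polar0 _ (@perp I X)); exact/COB_polar/COB_set0. Qed.

Lemma COB_bijoin (U V : set X) :
  COB perp U -> COB perp V -> COB perp (bijoin perp U V).
Proof.
move=> cU cV; rewrite /bijoin polarU.
by apply/COB_polar/COB_setI; exact: COB_polar.
Qed.

Lemma COB_bicyl i (U : set X) : COB perp U -> COB perp (bicyl perp (acc i) U).
Proof.
have [_ _ /(_ i)[_ _ cR _] _] := cuvoP X.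
by move=> /cR ?; do 2 apply: COB_polar.
Qed.

Lemma COB_Diag i k : COB perp (@Diag I X i k).
Proof. by have [_ [_ [_ _ [_ dB _] _]] _ dC] := cuvoP X; split. Qed.

Lemma COB_open (U : set X) : COB perp U -> open U.
Proof. by move=> [[]]. Qed.

End CuvoFacts.

Section CuvoMapFacts.
Context {I : Type}.

Lemma cuvo_map_polar (X Y : cuvo I) (f : cuvo_map X Y) (U : set Y) :
  open U -> f @^-1` (polar perp U) = polar perp (f @^-1` U).
Proof.
have [_ f2 f3 _ _] := cuvo_mapP f => oU; apply/seteqP; split=> x /= xU.
  by move=> y /= /xU pxy; apply: contrapT => /f2; apply.
move=> z Uz; apply: contrapT => nz.
have {nz} : ~ perp z (f x) by move=> /cuvo_orthoframe.2.
move=> /f3[w nwx zw]; apply: nwx; apply: cuvo_orthoframe.2.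
by apply: xU; exact: zw.
Qed.

Lemma cuvo_map_COB (X Y : cuvo I) (f : cuvo_map X Y) (U : set Y) :
  COB perp U -> COB perp (f @^-1` U).
Proof.
have [f1 _ _ _ _] := cuvo_mapP f => cU; split; first exact: f1 cU.1.
rewrite /biortho /= -cuvo_map_polar; last exact: COB_open.
rewrite -cuvo_map_polar; last exact/COB_open/COB_polar.
by congr (_ @^-1` _); exact: cU.2.
Qed.

Lemma cuvo_map_spec_le (X Y : cuvo I) (f : cuvo_map X Y) (x y : X) :
  spec_le x y -> spec_le (f x) (f y).
Proof.
move=> xy U oU Ufx.
have [_ [[_ /(_ (f x)) bY] _ _ _ _]] := @cuvo_UVO I Y.
have /bY[V [cV Vfx] VU] : nbhs (f x) U by exact: open_nbhs_nbhs.
by apply: VU; apply: (xy (f @^-1` V)) => //; exact/COB_open/cuvo_map_COB.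
Qed.

Lemma cuvo_map_eq (X Y : cuvo I) (f g : cuvo_map X Y) :
  (forall x, f x = g x) -> f = g.
Proof.
case: f g => [f fP] [g gP] /= /funext fg; rewrite {}fg in fP *.
by rewrite (Prop_irrelevance fP gP).
Qed.

Lemma cuvo_id_subproof (X : cuvo I) : is_cuvo_map (fun x : X => x).
Proof.
by split=> //= y z nzy; exists z => // U.
Qed.

Lemma cuvo_comp_subproof (X Y Z : cuvo I)
  (g : cuvo_map Y Z) (f : cuvo_map X Y) : is_cuvo_map (fun x => g (f x)).
Proof.
have [g1 g2 g3 g4 g5] := cuvo_mapP g; have [f1 f2 f3 f4 f5] := cuvo_mapP f.
split.
- by move=> U /g1/f1.
- by move=> x y /f2/g2.
- move=> y z /g3[x' /f3[x nxy x'x] zx']; exists x => // U oU /(zx' _ oU).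
  exact: (cuvo_map_spec_le x'x).
- move=> i U cU.
  have /= -> := f4 i (g @^-1` U) (cuvo_map_COB g cU).
  by rewrite (g4 i U cU).
- by move=> i k; rewrite -[RHS]f5 -[in RHS]g5.
Qed.

End CuvoMapFacts.

Program Definition CUVO (I : Type) : category := {|
  obj := cuvo I;
  hom := @cuvo_map I;
  idm X := CuvoMap (@cuvo_id_subproof I X);
  comp X Y Z g f := CuvoMap (cuvo_comp_subproof g f) |}.
Next Obligation. by move=> *; exact: cuvo_map_eq. Qed.
Next Obligation. by move=> *; exact: cuvo_map_eq. Qed.
Next Obligation. by move=> *; exact: cuvo_map_eq. Qed.

Record cob (I : Type) (X : cuvo I) := Cob {
  cob_set :> set X;
  cobP : COB perp cob_set }.

Arguments Cob {I X} cob_set cobP.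

Section CobLattice.
Context {I : Type} {X : cuvo I}.
Implicit Types U V W : cob X.

HB.instance Definition _ := gen_eqMixin (cob X).
HB.instance Definition _ := gen_choiceMixin (cob X).

Lemma cob_eq U V : cob_set U = cob_set V -> U = V.
Proof.
case: U V => [U UP] [V VP] /= UV; rewrite {}UV in UP *.
by rewrite (Prop_irrelevance UP VP).
Qed.

Definition cob_le U V : bool := `[< cob_set U `<=` cob_set V >].

Lemma cob_le_refl : reflexive cob_le.
Proof. by move=> U; exact/asboolP. Qed.

Lemma cob_le_anti : antisymmetric cob_le.
Proof.
by move=> U V /andP[/asboolP UV /asboolP VU]; apply/cob_eq/seteqP.
Qed.

Lemma cob_le_trans : transitive cob_le.
Proof.
move=> V U W /asboolP UV /asboolP VW; apply/asboolP.
exact: subset_trans UV VW.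
Qed.

Fact cob_display : Order.disp_t. Proof. exact: Order.Disp tt tt. Qed.

HB.instance Definition _ := Order.Le_isPOrder.Build cob_display (cob X)
  cob_le_refl cob_le_anti cob_le_trans.

Definition cobI U V : cob X := Cob _ (COB_setI (cobP U) (cobP V)).

Definition cobU U V : cob X := Cob _ (COB_bijoin (cobP U) (cobP V)).

Lemma cobIP U V W : (U <= cobI V W)%O = (U <= V)%O && (U <= W)%O.
Proof.
apply/asboolP/andP => [UVW|[/asboolP UV /asboolP UW]]; last first.
  by move=> x Ux; split; [exact: UV | exact: UW].
by split; apply/asboolP => x /UVW[].
Qed.

Lemma cobUP U V W : (cobU U V <= W)%O = (U <= W)%O && (V <= W)%O.
Proof.
have ofX := @cuvo_orthoframe I X.
apply/asboolP/andP => [UVW|[/asboolP UW /asboolP VW]].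
  by split; apply/asboolP => x ?; apply/UVW/(sub_polar2 ofX); [left|right].
have [_ ->] := cobP W; do 2 apply: polarS.
by move=> x [/UW|/VW].
Qed.

HB.instance Definition _ := Order.POrder_MeetJoin_isLattice.Build cob_display
  (cob X) cobIP cobUP.

Lemma cob0P U : (Cob _ COB_set0 <= U)%O.
Proof. by apply/asboolP. Qed.

Lemma cobTP U : (U <= Cob _ COB_setT)%O.
Proof. by apply/asboolP. Qed.

HB.instance Definition _ := Order.hasBottom.Build cob_display (cob X) cob0P.
HB.instance Definition _ := Order.hasTop.Build cob_display (cob X) cobTP.

End CobLattice.

Definition A0 (I : Type) (X : cuvo I) : cylAlg I := {|
  alg_lattice := cob X;
  orth := fun U : cob X => Cob _ (COB_polar (cobP U));
  cyl := fun i (U : cob X) => Cob _ (COB_bicyl i (cobP U));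
  diag := fun i k => Cob _ (COB_Diag i k) |}.

Definition A1 (I : Type) (X Y : cuvo I) (f : cuvo_map X Y) : A0 Y -> A0 X :=
  fun U : cob Y => Cob (f @^-1` U) (cuvo_map_COB f (cobP U)).

Definition is_proper_filter d (L : tbLatticeType d) (x : set L) : Prop :=
  [/\ x !=set0,
      forall a b, x a -> (a <= b)%O -> x b,
      forall a b, x a -> x b -> x (a `&` b)%O
    & x <> setT].

Record lfilter d (L : tbLatticeType d) := LFilter {
  lf_set :> set L;
  lfP : is_proper_filter lf_set }.

Definition phi d (L : tbLatticeType d) (a : L) : set (lfilter L) :=
  [set x | lf_set x a].

Section FilterSpace.
Context {d : Order.disp_t} {L : tbLatticeType d}.

HB.instance Definition _ := gen_eqMixin (lfilter L).
HB.instance Definition _ := gen_choiceMixin (lfilter L).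

Lemma phi_cover : \bigcup_(U in range (@phi d L)) U = setT.
Proof.
apply/seteqP; split=> x // _; exists (phi \top%O); first by exists \top%O.
by have [[a xa] up _ _] := lfP x; apply: up xa (lex1 a).
Qed.

Lemma phi_join (U V : set (lfilter L)) (x : lfilter L) :
  range (@phi d L) U -> range (@phi d L) V -> U x -> V x ->
  exists W, [/\ range (@phi d L) W, W x & W `<=` U `&` V].
Proof.
move=> [a _ <-] [b _ <-] xa xb; exists (phi (a `&` b)%O); split.
- by exists (a `&` b)%O.
- by have [_ _ + _] := lfP x; apply.
- move=> y yab; have [_ up _ _] := lfP y.
  by split; apply: up yab _; rewrite (leIl, leIr).
Qed.

HB.instance Definition _ := @isBaseTopological.Build (lfilter L)
  (set (lfilter L)) (range (@phi d L)) id phi_cover phi_join.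

End FilterSpace.

Definition S0 (I : Type) (A : col I) : cylFrame I := {|
  frame_space := lfilter A;
  perp := fun x y : lfilter A => exists2 a, lf_set x a & lf_set y (orth a);
  acc := fun i (x y : lfilter A) => cyl i @` lf_set x `<=` lf_set y;
  Diag := fun i k => phi (diag i k) |}.

Lemma col_hom_preim_subproof (I : Type) (A B : col I) (h : col_hom A B)
  (x : lfilter B) : is_proper_filter (h @^-1` lf_set x).
Proof.
have [[hI _] [h0 h1] _ _ _] := col_homP h.
have [[b xb] up xI nT] := lfP x; split.
- by exists \top%O; rewrite /= h1; exact: up xb (lex1 b).
- move=> a c /= xa ac; apply: up xa _.
  by rewrite leEmeet -hI; apply/eqP; congr (h _); apply/eqP; rewrite -leEmeet.
- by move=> a c /= xa xc; rewrite hI; exact: xI.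
- move=> xT; apply: nT; apply/seteqP; split=> c // _.
  have : (h @^-1` lf_set x) \bot%O by rewrite xT.
  by rewrite /= h0 => /up; apply; exact: le0x.
Qed.

Definition S1 (I : Type) (A B : col I) (h : col_hom A B) : S0 B -> S0 A :=
  fun x : lfilter B => LFilter (col_hom_preim_subproof h x).

Definition A_F (I : Type)
    (A0P : forall X : cuvo I, is_col (A0 X))
    (A1P : forall (X Y : cuvo I) (f : cuvo_map X Y), is_col_hom (A1 f)) :
    cofunctor_data (CUVO I) (COL I) := {|
  fobj := fun X : CUVO I => Col (A0P X) : COL I;
  fmor := fun (X Y : CUVO I) (f : hom X Y) =>
    @ColHom I (Col (A0P Y)) (Col (A0P X)) (A1 f) (A1P X Y f) |}.

Definition S_F (I : Type)
    (S0P : forall A : col I, is_cuvo (S0 A))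
    (S1P : forall (A B : col I) (h : col_hom A B), is_cuvo_map (S1 h)) :
    cofunctor_data (COL I) (CUVO I) := {|
  fobj := fun A : COL I => Cuvo (S0P A) : CUVO I;
  fmor := fun (A B : COL I) (h : hom A B) =>
    @CuvoMap I (Cuvo (S0P B)) (Cuvo (S0P A)) (S1 h) (S1P A B h) |}.

(* Main.v *)
From mathcomp Require Import all_boot all_order.
From mathcomp Require Import boolp classical_sets functions filter.
From mathcomp Require Import topology_structure compact separation_axioms.
Require Import Defs.

Set Implicit Arguments.
Unset Strict Implicit.
Unset Printing Implicit Defensive.

Import Order.TTheory.

Local Open Scope classical_set_scope.

(** This is a Stone duality in which all proper filters are points, so no prime
    filter theorem is needed.

    Whenever a point with prescribed properties is wanted in the space of an
    algebra, it is written down as the filter generated by a down-directed set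
    that misses the bottom ([lfilter_of_base]).  Three bases suffice: a
    singleton [a], giving the least point of [phi a]; the image of a filter
    under a quantifier, giving its least successor for that quantifier; and
    the image of a filter under a homomorphism, giving the back condition on
    the dual map.

    Since [phi a] has a least point, every open set around that point contains
    [phi a], so [phi a] is compact; and a filter orthogonal to that point
    contains the orthocomplement of [a], so [polar perp (phi a)] is
    [phi (orth a)].  A compact open set is a finite union of sets [phi a], its
    polar is a finite intersection of such sets, and so the biorthogonally
    closed compact open sets are exactly the sets [phi a] ([S0_COBE]).  This
    settles the unit on algebras: [phi] is a bijection onto the dual algebra,
    and it respects the operations because each of them has been computed on
    the sets [phi a].  It also reduces each condition on the dual space to an
    identity of the algebra.

    From a space to its algebra, the point is that the relational image of a
    set in [COB perp] is already biorthogonally closed, so its closure in the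
    definition of the quantifier does nothing ([bicylE]); the quantifier laws
    then follow from the fact that the polar of a set closed under the
    accessibility relation is closed as well ([rimage_polar]).

    The unit on spaces sends a point to its filter of neighbourhoods in
    [COB perp].  It is injective by the T0 axiom, surjective because proper
    filters of [COB perp] come from points, and it preserves and reflects
    orthogonality.  A bijective map of this kind is an isomorphism as soon as
    its inverse pulls basic sets back to compact open sets
    ([cuvo_homeo_iso]). *)

(** * Compact open sets *)

(** A compact open set is a finite union of basic open sets.  An induction
    principle spares the bookkeeping of finite families: if [U] were not in
    [P], the sets containing [U] minus some member of [P] inside [U] would
    form a proper filter, and any basic neighbourhood inside [U] of a cluster
    point in [U] contradicts clustering. *)
Lemma compact_open_ind (X : topologicalType) (B P : set (set X)) :
  basis B -> B `<=` P -> P set0 ->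
  (forall U V, P U -> P V -> P (U `|` V)) -> CO `<=` P.
Proof.
move=> [Bopen Bnbhs] BP P0 PU U [cU oU].
apply: contrapT => nPU.
pose F := [set W : set X | exists V, [/\ P V, V `<=` U & U `\` V `<=` W]].
have FF : ProperFilter F.
  split.
    move=> [V [PV VU UV0]]; apply: nPU; suff -> : U = V by [].
    apply/seteqP; split=> // x Ux; apply: contrapT => nVx.
    by apply: (UV0 x).
  split.
  - by exists set0; split.
  - move=> W W' [V [PV VU UVW]] [V' [PV' VU' UVW']].
    exists (V `|` V'); split; first exact: PU.
      by move=> x [/VU|/VU'].
    move=> x [Ux nVx]; split.
      by apply: UVW; split=> // Vx; apply: nVx; left.
    by apply: UVW'; split=> // Vx; apply: nVx; right.
  - move=> W W' WW' [V [PV VU UVW]]; exists V; split=> //.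
    exact: subset_trans UVW WW'.
have FU : F U by exists set0; split=> //; exact: subDsetl.
have [p [Up clp]] := cU F FF FU.
have /Bnbhs[V [BV Vp] VU] : nbhs p U by exact: open_nbhs_nbhs.
have FV : F (U `\` V) by exists V; split=> //; exact: BP.
have Vnbhs : nbhs p V by apply: open_nbhs_nbhs; split=> //; exact: Bopen.
by have [x [[_ nVx] /nVx]] := clp _ _ FV Vnbhs.
Qed.

Lemma CO_setU (X : topologicalType) (U V : set X) :
  CO U -> CO V -> CO (U `|` V).
Proof. by move=> [cU oU] [cV oV]; split; [exact: compactU|exact: openU]. Qed.

Lemma spectral_basis (X Y : topologicalType) (B : set (set Y)) (f : X -> Y) :
  basis B -> (forall U, B U -> CO (f @^-1` U)) ->
  forall U, CO U -> CO (f @^-1` U).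
Proof.
move=> bB fB U; apply: (compact_open_ind (P := [set U | CO (f @^-1` U)]) bB fB).
- by rewrite /= preimage_set0; split; [exact: compact0|exact: open0].
- by move=> V W; rewrite /= preimage_setU; exact: CO_setU.
Qed.

(** * Relational images in monadic orthoframes *)

Section MonadicOrthoframe.
Context {X : Type} {perp R : X -> X -> Prop}.
Hypothesis RP : is_monadic_orthoframe perp R.
Implicit Types U V : set X.

Lemma rimage_sub U : U `<=` rimage R U.
Proof. by have [_ Rr _ _] := RP; move=> x Ux; exists x. Qed.

Lemma rimageS U V : U `<=` V -> rimage R U `<=` rimage R V.
Proof. by move=> UV y [x /UV Vx xy]; exists x. Qed.

Lemma rimage_idem U : rimage R (rimage R U) = rimage R U.
Proof.
have [_ _ Rt _] := RP; apply/seteqP; split; last exact: rimage_sub.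
by move=> z [y [x Ux xy] yz]; exists x => //; exact: Rt xy yz.
Qed.

(** The axiom of monadic orthoframes, stated for images of points, extends to
    arbitrary sets because the polar of a union is an intersection. *)
Lemma rimage_polar U :
  rimage R (polar perp (rimage R U)) = polar perp (rimage R U).
Proof.
have [_ _ _ Rp] := RP; apply/seteqP; split; last exact: rimage_sub.
move=> z [y yU yz] w [x Ux xw]; apply: (Rp x); last by exists x.
by exists y => // v [_ -> xv]; apply: yU; exists x.
Qed.

Lemma rimage_polar2 U : rimage R (polar perp (polar perp (rimage R U))) =
  polar perp (polar perp (rimage R U)).
Proof. by rewrite -(rimage_polar U) rimage_polar. Qed.

End MonadicOrthoframe.

(** * The algebra of a cylindric UVO-space *)

Section CuvoAlgebra.
Context {I : Type}.

Section OneSpace.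
Context {X : cuvo I}.
Implicit Types U V : set X.

Lemma cuvo_monadic i : is_monadic_orthoframe (@perp I X) (acc i).
Proof. by have [_ [_ [/(_ i)]]] := cuvoP X. Qed.

Lemma COB_rimage i U : COB perp U -> COB perp (rimage (acc i) U).
Proof. by have [_ _ /(_ i)[_ _ + _] _] := cuvoP X; apply. Qed.

Lemma bicylE i U : COB perp U -> bicyl perp (acc i) U = rimage (acc i) U.
Proof. by move=> /(COB_rimage i)[_ /esym]. Qed.

(** The image of [U `|` V] is the union of the images, so only the passage to
    the biorthogonal closure matters.  The closure of an image is stable under
    the relation ([rimage_polar2]) and contains the closure of [U `|` V], hence
    also its image. *)
Lemma rimage_bijoin i U V : COB perp U -> COB perp V ->
  rimage (acc i) (bijoin perp U V) =
  bijoin perp (rimage (acc i) U) (rimage (acc i) V).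
Proof.
have RP := cuvo_monadic i; have oX := @cuvo_orthoframe I X => cU cV.
have rU : rimage (acc i) U `|` rimage (acc i) V = rimage (acc i) (U `|` V).
  apply/seteqP; split=> [x [|]|x [y [Uy|Vy] yx]].
  - by apply: rimageS => y; left.
  - by apply: rimageS => y; right.
  - by left; exists y.
  - by right; exists y.
rewrite /bijoin rU; apply/seteqP; split.
  rewrite -(rimage_polar2 RP); apply: rimageS; do 2 apply: polarS.
  exact: rimage_sub RP _.
have [_ ->] := COB_rimage i (COB_bijoin cU cV).
by do 2 apply: polarS; apply: rimageS; exact: sub_polar2.
Qed.

Lemma rimage_comm i k U :
  rimage (acc i) (rimage (acc k) U) = rimage (acc k) (rimage (acc i) U).
Proof.
have rcompE j l : rimage (acc j) (rimage (acc l) U) =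
    rimage (rcomp (acc l) (acc j)) U.
  apply/seteqP; split=> [z [y [x Ux xy] yz]|z [x Ux [y xy yz]]].
    by exists x => //; exists y.
  by exists y => //; exists x.
by rewrite !rcompE; have [_ [_ [_ -> _ _]] _ _] := cuvoP X.
Qed.

End OneSpace.

Lemma A0_is_col (X : cuvo I) : is_col (A0 X).
Proof.
have oX := @cuvo_orthoframe I X; split.
  split.
  - move=> U; apply: cob_eq; apply/seteqP; split=> // x /= [Ux /(_ x Ux)].
    exact: oX.1.
  - move=> U; apply: cob_eq => /=; rewrite /bijoin polarU.
    suff -> : polar perp U `&` polar perp (polar perp U) = set0.
      exact: polar0.
    by apply/seteqP; split=> // x [Ux /(_ x Ux)]; exact: oX.1.
  - by move=> U V /asboolP UV; apply/asboolP; exact: polarS.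
  - by move=> U; apply: cob_eq; rewrite /= -(cobP U).2.
have cylE i (U : A0 X) : cob_set (cyl i U) = rimage (acc i) U.
  by rewrite /= bicylE //; exact: cobP.
split.
- move=> i; have RP := @cuvo_monadic X i; split.
  + move=> U V; apply: cob_eq; rewrite cylE.
    rewrite /= rimage_bijoin; [|exact: cobP..].
    by rewrite -!bicylE; [|exact: cobP..].
  + apply: cob_eq; rewrite cylE; apply/seteqP; split=> // x.
    by case.
  + by move=> U; apply: cob_eq; rewrite !cylE (rimage_idem RP).
  + by move=> U; apply/asboolP; rewrite cylE; exact: rimage_sub RP _.
  + move=> U; apply: cob_eq; rewrite !cylE /=.
    by rewrite bicylE ?(rimage_polar RP) //; exact: cobP.
- by move=> i k U; apply: cob_eq; rewrite !cylE rimage_comm.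
- have [_ [_ [_ _ [dC _ dT] _]] _ _] := cuvoP X.
  by split=> [i k|i]; apply: cob_eq; [exact: dC|exact: dT].
- move=> i k l ik lk; apply: cob_eq; rewrite cylE /=.
  by have [_ [_ [_ _ _ ->]]] := cuvoP X.
Qed.

Lemma A1_is_col_hom (X Y : cuvo I) (f : cuvo_map X Y) : is_col_hom (A1 f).
Proof.
have [_ _ _ fR fD] := cuvo_mapP f.
split.
- split=> U V; apply: cob_eq => //=.
  have oU := COB_open (cobP U); have oV := COB_open (cobP V).
  rewrite /bijoin -preimage_setU -cuvo_map_polar; last exact: openU.
  rewrite -cuvo_map_polar // polarU.
  by apply/COB_open/COB_setI; exact/COB_polar/cobP.
- by split; exact: cob_eq.
- by move=> U; apply: cob_eq; rewrite /= cuvo_map_polar //; exact/COB_open/cobP.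
- move=> i U; apply: cob_eq => /=; rewrite bicylE; last exact: cobP.
  by rewrite bicylE -?fR //; [exact: cobP|exact/cuvo_map_COB/cobP].
- by move=> i k; apply: cob_eq => /=; rewrite fD.
Qed.

End CuvoAlgebra.

(** * The space of proper filters of a bounded lattice *)

Section LatticeFilters.
Context {d : Order.disp_t} {L : tbLatticeType d}.
Implicit Types (a b : L) (x y : lfilter L) (S : set L).

Lemma lfilter_eq x y : lf_set x = lf_set y -> x = y.
Proof.
case: x y => [x xP] [y yP] /= xy; rewrite {}xy in xP *.
by rewrite (Prop_irrelevance xP yP).
Qed.

Lemma lf_up x a b : lf_set x a -> (a <= b)%O -> lf_set x b.
Proof. by have [_ + _ _] := lfP x; apply. Qed.

Lemma lf_meet x a b : lf_set x a -> lf_set x b -> lf_set x (a `&` b)%O.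
Proof. by have [_ _ + _] := lfP x; apply. Qed.

Lemma lf_top x : lf_set x \top%O.
Proof. by have [[a xa] _ _ _] := lfP x; exact: lf_up xa (lex1 a). Qed.

Lemma lf_bot x : ~ lf_set x \bot%O.
Proof.
have [_ _ _ xT] := lfP x => x0; apply: xT; apply/seteqP; split=> // a _.
exact: lf_up x0 (le0x a).
Qed.

Lemma lfilter_of_base S : S !=set0 ->
  (forall a b, S a -> S b -> exists2 c, S c & (c <= a `&` b)%O) ->
  ~ S \bot%O ->
  exists x, lf_set x = [set b | exists2 a, S a & (a <= b)%O].
Proof.
move=> [a Sa] SI S0.
suff xP : is_proper_filter [set b | exists2 a, S a & (a <= b)%O].
  by exists (LFilter xP).
split.
- by exists a, a.
- by move=> b c [e Se eb] bc; exists e => //; exact: le_trans eb bc.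
- move=> b c [b' Sb bb] [c' Sc cc]; have [e Se /le_trans ebc] := SI _ _ Sb Sc.
  by exists e => //; apply: ebc; exact: leI2.
- move=> xT; have : [set: L] \bot%O by [].
  by rewrite -xT => -[b Sb]; rewrite lex0 => /eqP b0; rewrite b0 in Sb.
Qed.

(** The least point of [phi a]. *)
Lemma principal_lfilter a : a <> \bot%O ->
  exists x, lf_set x = [set b | (a <= b)%O].
Proof.
move=> a0; have [||/esym//|x xE] := @lfilter_of_base [set a].
- by exists a.
- by move=> _ _ -> ->; exists a; rewrite ?meetxx.
by exists x; rewrite xE; apply/seteqP; split=> [b [c ->]|b ab] //; exists a.
Qed.

Lemma phiI a b : phi (a `&` b)%O = phi a `&` phi b.
Proof.
apply/seteqP; split=> x /= => [xab|[]]; last exact: lf_meet.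
by split; apply: (lf_up xab); rewrite ?leIl ?leIr.
Qed.

Lemma phi0 : phi (\bot%O : L) = set0.
Proof. by apply/seteqP; split=> // x /lf_bot. Qed.

Lemma phi1 : phi (\top%O : L) = setT.
Proof. by apply/seteqP; split=> // x _; exact: lf_top. Qed.

Lemma phi_le a b : phi a `<=` phi b -> (a <= b)%O.
Proof.
move=> ab; have [->|/eqP a0] := eqVneq a \bot%O; first exact: le0x.
have [x xE] := principal_lfilter a0.
by have : phi b x; [apply: ab|]; rewrite /phi /= xE /=.
Qed.

Lemma phi_inj : injective (@phi d L).
Proof.
by move=> a b ab; apply/le_anti/andP; split; apply: phi_le; rewrite ab.
Qed.

Lemma phi_open a : open (phi a).
Proof.
by exists [set phi a]; [move=> _ ->; exists a|rewrite bigcup_set1].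
Qed.

Lemma phi_nbhs (U : set (lfilter L)) x : open U -> U x ->
  exists2 a, lf_set x a & phi a `<=` U.
Proof.
move=> [D Dphi <-] [V DV Vx]; have [a _ aV] := Dphi _ DV.
exists a; first by move: Vx; rewrite /= -aV.
by move=> y ya; exists V => //; rewrite /= -aV.
Qed.

Lemma phi_basis : basis (range (@phi d L)).
Proof.
split=> [_ [a _ <-]|x U]; first exact: phi_open.
rewrite nbhsE => -[V [oV Vx] VU]; have [a xa aV] := phi_nbhs oV Vx.
by exists (phi a); [split=> //; exists a|exact: subset_trans VU].
Qed.

(** Every open set around the least point of [phi a] contains [phi a], so
    that point is a cluster point of every proper filter containing [phi a]. *)
Lemma phi_compact a : compact (phi a).
Proof.
have [->|/eqP a0] := eqVneq a \bot%O; first by rewrite phi0; exact: compact0.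
have [x xE] := principal_lfilter a0.
have xa : phi a x by rewrite /phi /= xE /=.
move=> F FF Fa; exists x; split=> // V W FV.
rewrite nbhsE => -[U [oU Ux] UW]; have [b] := phi_nbhs oU Ux.
rewrite xE /= => ab bU; have [y [Vy ya]] := filter_ex (filterI FV Fa).
by exists y; split=> //; apply/UW/bU; exact: lf_up ya ab.
Qed.

Lemma phi_CO a : CO (phi a).
Proof. by split; [exact: phi_compact|exact: phi_open]. Qed.

Lemma lfilter_kolmogorov : kolmogorov_space (lfilter L).
Proof.
move=> x y /eqP xy; apply: contrapT => nA; apply: xy; apply: lfilter_eq.
suff sub u v : (forall A : set (lfilter L),
    ~ (A \in nbhs u /\ v \in ~` A)) -> lf_set u `<=` lf_set v.
  by apply/seteqP; split; apply: sub => A hA; apply: nA; exists A; [left|right].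
move=> uv a ua; apply: contrapT => nva; apply: (uv (phi a)).
rewrite !inE; split=> //; apply: open_nbhs_nbhs; split=> //; exact: phi_open.
Qed.

Lemma phi_spec_le x y : lf_set x `<=` lf_set y -> spec_le x y.
Proof. by move=> xy U oU Ux; have [a /xy ya] := phi_nbhs oU Ux; apply. Qed.

End LatticeFilters.

(** * The cylindric UVO-space of an algebra *)

Section FilterFrame.
Context {I : Type} {A : col I}.
Implicit Types (a b : A) (x y z : S0 A).

Lemma orthI a : (a `&` orth a)%O = \bot%O.
Proof. by have [[]] := colP A. Qed.

Lemma orth_le a b : (a <= b)%O -> (orth b <= orth a)%O.
Proof. by have [[_ _ + _] _] := colP A; apply. Qed.

Lemma orthK a : orth (orth a) = a.
Proof. by have [[]] := colP A. Qed.

Lemma orth_le_swap a b : (a <= orth b)%O -> (b <= orth a)%O.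
Proof. by move=> /orth_le; rewrite orthK. Qed.

Lemma orthU a b : orth (orth a `&` orth b)%O = (a `|` b)%O.
Proof.
apply/le_anti/andP; split.
  rewrite -[leRHS]orthK; apply: orth_le.
  by rewrite lexI !orth_le ?leUl ?leUr.
by rewrite leUx; apply/andP; split; apply: orth_le_swap; rewrite ?leIl ?leIr.
Qed.

Lemma orth0 : orth (\bot%O : A) = \top%O.
Proof. by apply/eqP; rewrite -le1x; apply: orth_le_swap; exact: le0x. Qed.

Lemma cylU i a b : cyl i (a `|` b)%O = (cyl i a `|` cyl i b)%O.
Proof. by have [_ [/(_ i)[]]] := colP A. Qed.

Lemma cylK i a : cyl i (cyl i a) = cyl i a.
Proof. by have [_ [/(_ i)[]]] := colP A. Qed.

Lemma cyl_ge i a : (a <= cyl i a)%O.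
Proof. by have [_ [/(_ i)[]]] := colP A. Qed.

Lemma cyl_orth i a : cyl i (orth (cyl i a)) = orth (cyl i a).
Proof. by have [_ [/(_ i)[]]] := colP A. Qed.

Lemma cyl_le i a b : (a <= b)%O -> (cyl i a <= cyl i b)%O.
Proof. by move=> /join_idPl <-; rewrite cylU leUr. Qed.

Lemma cyl_eq0 i a : cyl i a = \bot%O -> a = \bot%O.
Proof. by move=> a0; apply/eqP; rewrite -lex0 -a0 cyl_ge. Qed.

Lemma S0_orthoframe : is_orthoframe (@perp I (S0 A)).
Proof.
split=> [x [a xa xoa]|x y [a xa yoa]].
  by apply: (@lf_bot _ _ x); rewrite -(orthI a); exact: lf_meet.
by exists (orth a); rewrite ?orthK.
Qed.

(** A filter orthogonal to all of [phi a] is orthogonal to its least point,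
    the principal filter of [a]; the witness [b] of this orthogonality then has
    [a <= orth b], that is, [b <= orth a]. *)
Lemma phi_orth a : polar (@perp I (S0 A)) (phi a) = phi (orth a).
Proof.
apply/seteqP; split=> x; last first.
  by move=> xa y ya; exists (orth a) => //; rewrite orthK.
move=> xa; have [->|/eqP a0] := eqVneq a \bot%O.
  by rewrite orth0; exact: lf_top.
have [y yE] := principal_lfilter a0.
have [|b xb] := xa y; first by rewrite /phi /= yE /=.
by rewrite yE => /= /orth_le_swap; exact: lf_up.
Qed.

Lemma phi_biortho a : biortho (@perp I (S0 A)) (phi a).
Proof. by rewrite /biortho /= !phi_orth orthK. Qed.

Lemma phi_join_bijoin a b :
  phi (a `|` b)%O = bijoin (@perp I (S0 A)) (phi a) (phi b).
Proof. by rewrite /bijoin polarU !phi_orth -phiI phi_orth orthU. Qed.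

(** Unions of basic sets need not be basic, but their polars are, since polars
    turn unions into intersections.  Hence the polar of a compact open set is
    basic, and taking polars once more recovers any biorthogonally
    closed set. *)
Lemma S0_COBE : COB (@perp I (S0 A)) = range (@phi _ A).
Proof.
apply/seteqP; split=> [U [coU ->]|_ [a _ <-]]; last first.
  by split; [exact: phi_CO|exact: phi_biortho].
suff [a ->] : exists a, polar (@perp I (S0 A)) U = phi a.
  by rewrite phi_orth; exists (orth a).
pose P := [set V | exists a, polar (@perp I (S0 A)) V = phi a].
apply: (compact_open_ind (P := P) (@phi_basis _ A)) coU => [_ [a _ <-]||V W /=].
- by exists (orth a); exact: phi_orth.
- by exists \top%O; rewrite polar0 phi1.
- by move=> [a Va] [b Wb]; exists (a `&` b)%O; rewrite polarU Va Wb phiI.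
Qed.

Lemma S0_UVO : is_UVO (@perp I (S0 A)).
Proof.
split; first by split; [exact: S0_orthoframe|exact: lfilter_kolmogorov].
rewrite S0_COBE; split.
- exact: phi_basis.
- by move=> _ _ [a _ <-] [b _ <-]; exists (a `&` b)%O; rewrite ?phiI.
- by move=> _ [a _ <-]; exists (orth a); rewrite ?phi_orth.
- move=> F [FB [U FU] Fup FI FnB]; have [a _ aU] := FB _ FU; subst U.
  have xP : is_proper_filter [set a | F (phi a)].
    split.
    - by exists a.
    - move=> b c /= Fb bc; apply: (Fup _ _ Fb); first by exists c.
      by move=> x xb; exact: lf_up xb bc.
    - by move=> b c /= Fb Fc; rewrite phiI; exact: FI.
    - move=> FT; apply: FnB; apply/seteqP; split=> // _ [b _ <-].
      by have : [set: A] b by []; rewrite -FT.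
  exists (LFilter xP); rewrite /COB_at S0_COBE; apply/seteqP; split=> U.
    by move=> FV; have [b _ bU] := FB _ FV; subst U; split=> //; exists b.
  by move=> [[b _ <-]].
- move=> x y [a xa yoa]; exists (phi a).
  by rewrite phi_orth; split=> //; exists a.
Qed.

(** The least successor of [x] for [acc i]. *)
Lemma cyl_image_lfilter i x :
  exists y : S0 A,
    lf_set y = [set b | exists2 a, lf_set x a & (cyl i a <= b)%O].
Proof.
have [|||y yE] := @lfilter_of_base _ A (cyl i @` lf_set x).
- by exists (cyl i \top%O), \top%O => //; exact: lf_top.
- move=> _ _ [a xa <-] [b xb <-]; exists (cyl i (a `&` b)%O).
    by exists (a `&` b)%O => //; exact: lf_meet.
  by rewrite lexI !cyl_le ?leIl ?leIr.
- by move=> [a xa /cyl_eq0 a0]; apply: (@lf_bot _ _ x); rewrite -a0.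
exists y; rewrite yE; apply/seteqP; split=> b.
  by move=> [_ [a xa <-] ab]; exists a.
by move=> [a xa ab]; exists (cyl i a) => //; exists a.
Qed.

(** For the exchange axiom, a filter orthogonal to all successors of [x] is
    orthogonal to the least one, which makes [orth (cyl i a)] one of its
    members for some [a] in [x].  That element is fixed by [cyl i], so it
    passes to successors. *)
Lemma S0_monadic i : is_monadic_orthoframe (@perp I (S0 A)) (acc i).
Proof.
split; first exact: S0_orthoframe.
- by move=> x _ [a xa <-]; exact: lf_up xa (cyl_ge i a).
- move=> x y z xy yz _ [a xa <-]; apply: yz; exists (cyl i a).
    by apply: xy; exists a.
  exact: cylK.
- move=> x z [y ynx yz] w [_ -> xw].
  have [x' x'E] := cyl_image_lfilter i x.
  have [|b yb] := ynx x'.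
    by exists x => // _ [a xa <-]; rewrite x'E; exists a.
  rewrite x'E => -[a xa /orth_le_swap ab].
  exists (orth (cyl i a)).
    apply: yz; exists (orth (cyl i a)); rewrite ?cyl_orth //.
    exact: lf_up ab.
  by rewrite orthK; apply: xw; exists a.
Qed.

(** If [x] is related to [z] through some filter, in one order, then the least
    successor of [x] for the other quantifier serves in the other order. *)
Lemma S0_acc_comm i k : rcomp (@acc I (S0 A) i) (acc k) = rcomp (acc k) (acc i).
Proof.
have cylC := let: And4 _ c _ _ := (colP A).2 in c.
suff sub j l (x z : S0 A) :
    rcomp (acc j) (acc l) x z -> rcomp (acc l) (acc j) x z.
  by apply/funext => x; apply/funext => z; apply/propext; split; exact: sub.
move=> [y xy yz]; have [y' y'E] := cyl_image_lfilter l x; exists y'.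
  by move=> _ [a xa <-]; rewrite y'E; exists a.
move=> _ [b + <-]; rewrite y'E => -[a xa ab].
apply: lf_up (cyl_le j ab); rewrite cylC; apply: yz; exists (cyl j a) => //.
by apply: xy; exists a.
Qed.

(** Every filter containing [cyl i a] is a successor of the principal filter
    of [a], which is proper because [cyl i] fixes the bottom. *)
Lemma rimage_phi i a : rimage (@acc I (S0 A) i) (phi a) = phi (cyl i a).
Proof.
apply/seteqP; split=> [y [x xa]|y yca]; first by apply; exists a.
have [x xE] : exists x : lfilter A, lf_set x = [set b | (a <= b)%O].
  apply: principal_lfilter => a0; apply: (@lf_bot _ _ y).
  by have [_ [/(_ i)[_ <- _ _ _]]] := colP A; rewrite -a0.
exists x; first by rewrite /phi /= xE /=.
by move=> _ [b + <-]; rewrite xE => /(cyl_le i); exact: lf_up.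
Qed.

Lemma bicyl_phi i a : bicyl (@perp I (S0 A)) (acc i) (phi a) = phi (cyl i a).
Proof. by rewrite /bicyl rimage_phi !phi_orth orthK. Qed.

Lemma S0_is_cuvo : is_cuvo (S0 A).
Proof.
have [_ [_ _ [dC d1] dd]] := colP A.
split; first exact: S0_UVO.
- split; first exact: S0_orthoframe.
  split.
  + exact: S0_monadic.
  + exact: S0_acc_comm.
  + split=> [i k|i k|i] /=; first by rewrite dC.
      exact: phi_biortho.
    by rewrite d1 phi1.
  + by move=> i k l ik lk; rewrite -phiI rimage_phi dd.
- move=> i; split; [exact: S0_monadic|exact: S0_UVO| |].
  + by rewrite S0_COBE => _ [a _ <-]; rewrite rimage_phi; exists (cyl i a).
  + move=> x y /existsNP[_ /not_implyP[[a xa <-] nya]].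
    exists (phi (cyl i a)); split=> //.
      by rewrite S0_COBE; exists (cyl i a).
    exists (phi a); last by rewrite bicyl_phi.
    by split=> //; rewrite S0_COBE; exists a.
- by move=> i k; exact: phi_CO.
Qed.

End FilterFrame.

(** The back condition is witnessed by the filter generated by the image of
    [z].  If it were improper, or orthogonal to [y], then [h a] would be the
    bottom, or would lie below [b] for some [orth b] in [y], for some [a] in
    [z]; either way [h (orth a)] belongs to [y], which makes [z] orthogonal to
    the preimage of [y]. *)
Lemma S1_is_cuvo_map (I : Type) (A B : col I) (h : col_hom A B) :
  is_cuvo_map (S1 h).
Proof.
have [[hI _] [h0 h1] ho hc hd] := col_homP h.
split.
- apply: (spectral_basis (@phi_basis _ A)) => _ [a _ <-].
  exact: (@phi_CO _ B (h a)).
- move=> x y nxy [a xa yoa]; apply: nxy; exists (h a) => //.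
  by rewrite -ho.
- move=> y z nzy.
  have [|||x xE] := @lfilter_of_base _ B (h @` lf_set z).
  + by exists (h \top%O), \top%O => //; exact: lf_top.
  + move=> _ _ [a za <-] [b zb <-]; exists (h (a `&` b)%O); last by rewrite hI.
    by exists (a `&` b)%O => //; exact: lf_meet.
  + move=> [a za ha0]; apply: nzy; exists a => //=.
    by rewrite ho ha0 orth0; exact: lf_top.
  exists x.
    move=> [b]; rewrite xE => -[_ [a za <-] ab] yb; apply: nzy; exists a => //=.
    by rewrite ho; exact: lf_up yb (orth_le ab).
  by apply: phi_spec_le => a za; rewrite /= xE; exists (h a) => //; exists a.
- move=> i U; rewrite S0_COBE => -[a _ <-]; rewrite rimage_phi.
  by rewrite (rimage_phi i (h a)) -hc.
- by move=> i k; apply/seteqP; split=> x; rewrite /= /phi /= hd.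
Qed.

(** * Recognizing isomorphisms *)

Section Isomorphisms.
Context {I : Type}.

Lemma bijective_col_hom_iso (A B : col I) (h : col_hom A B) :
  bijective h -> @is_iso (COL I) A B h.
Proof.
move=> [g hK gK]; have [[hI hU] [h0 h1] ho hc hd] := col_homP h.
have hinj := can_inj hK.
have gP : is_col_hom g.
  split.
  - by split=> a b; apply: hinj; rewrite ?hI ?hU !gK.
  - by split; apply: hinj; rewrite gK ?h0 ?h1.
  - by move=> a; apply: hinj; rewrite ho !gK.
  - by move=> i a; apply: hinj; rewrite hc !gK.
  - by move=> i k; apply: hinj; rewrite hd gK.
by exists (ColHom gP); split; apply: col_hom_eq => a; [exact: hK|exact: gK].
Qed.

(** The remaining conditions on [g] are those on [f] read backwards; the back
    condition for [g] is witnessed by [f z] itself. *)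
Lemma cuvo_homeo_iso (X Y : cuvo I) (f : cuvo_map X Y) (g : Y -> X) :
  cancel f g -> cancel g f ->
  (forall x y, perp x y -> perp (f x) (f y)) ->
  (forall U, COB perp U -> CO (g @^-1` U)) ->
  @is_iso (CUVO I) X Y f.
Proof.
move=> fK gK fperp gCO; have [_ f2 _ f4 f5] := cuvo_mapP f.
have gperp x y : perp (g x) (g y) <-> perp x y.
  split=> [/fperp|xy]; first by rewrite !gK.
  by apply: contrapT => /f2; rewrite !gK.
have gpolar (U : set X) : g @^-1` polar perp U = polar perp (g @^-1` U).
  apply/seteqP; split=> y yU => [z Uz|x Ux]; first by apply/gperp/yU.
  by rewrite -[x]fK; apply/gperp/yU; rewrite /= fK.
have gCOB (U : set X) : COB perp U -> COB perp (g @^-1` U).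
  by move=> cU; split; [exact: gCO|rewrite /biortho /= -!gpolar -cU.2].
have fgK (U : set X) : f @^-1` (g @^-1` U) = U.
  by apply/seteqP; split=> x /=; rewrite fK.
have gfK (U : set Y) : g @^-1` (f @^-1` U) = U.
  by apply/seteqP; split=> x /=; rewrite gK.
have gP : is_cuvo_map g.
  split.
  - have [_ [bX _ _ _ _]] := @cuvo_UVO I X; exact: spectral_basis bX gCO.
  - by move=> x y nxy /gperp.
  - move=> y z nzy; exists (f z); last by rewrite fK.
    by move=> /gperp; rewrite fK.
  - move=> i U cU; rewrite -[in RHS](fgK U) (f4 i _ (gCOB _ cU)).
    by rewrite gfK.
  - by move=> i k; rewrite -f5 gfK.
by exists (CuvoMap gP); split; apply: cuvo_map_eq => a; [exact: fK|exact: gK].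
Qed.

End Isomorphisms.

(** * The unit on spaces *)

Section CuvoUnit.
Context {I : Type} (X : cuvo I).

Let B : col I := Col (A0_is_col X).

Lemma point_filter_proper (x : X) :
  is_proper_filter [set U : A0 X | cob_set U x].
Proof.
split.
- by exists (Cob _ COB_setT).
- by move=> U V Ux /asboolP; apply.
- by move=> U V Ux Vx; split.
- by move=> xT; have : [set: A0 X] (Cob _ COB_set0) by []; rewrite -xT.
Qed.

Definition point_filter (x : X) : S0 B := LFilter (point_filter_proper x).

Lemma point_filter_inj : injective point_filter.
Proof.
move=> x y xy; apply: contrapT => nxy.
have [[_ T0] [[_ bX] _ _ _ _]] := @cuvo_UVO I X.
have sub (u v : X) W : point_filter u = point_filter v -> nbhs u W -> W v.
  move=> uv /bX[U [cU Uu] UW]; apply: UW.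
  have : lf_set (point_filter u) (Cob _ cU) by [].
  by rewrite uv.
have [W [[]|[]]] := T0 x y (introN eqP nxy); rewrite !inE => xW; apply.
  exact: (sub x y).
exact: (sub y x).
Qed.

(** The filters of [A0 X] and the set filters of [COB perp] are the same thing
    up to the subtype [cob X], so the axiom on proper set filters applies. *)
Lemma point_filter_surj (u : S0 B) : exists x, point_filter x = u.
Proof.
have [_ [_ _ _ fX _]] := @cuvo_UVO I X.
have [|x xE] := fX (@cob_set I X @` lf_set u).
  split.
  - by move=> _ [U _ <-]; exact: cobP.
  - by exists setT, (Cob _ COB_setT) => //; exact: lf_top.
  - move=> _ V [U uU <-] cV UV; exists (Cob _ cV) => //.
    by apply: lf_up uU _; exact/asboolP.
  - move=> _ _ [U uU <-] [V uV <-]; exists (U `&` V)%O => //.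
    exact: lf_meet.
  - move=> uB; have [U uU U0] : (@cob_set I X @` lf_set u) set0.
      by rewrite uB; exact: COB_set0.
    apply: (@lf_bot _ _ u); suff <- : U = \bot%O by [].
    exact: cob_eq.
exists x; apply: lfilter_eq; apply/seteqP; split=> U /=.
  move=> Ux; have : COB_at perp x U by split=> //; exact: cobP.
  by rewrite -xE => -[V uV /cob_eq <-].
move=> uU; have : (@cob_set I X @` lf_set u) U by exists U.
by rewrite xE => -[].
Qed.

Lemma preimage_point_filter (U : A0 X) : point_filter @^-1` (phi U) = cob_set U.
Proof. by []. Qed.

(** Orthogonality of the filters is separation by a set of [COB perp] and its
    polar, which orthogonal points admit by one of the axioms of the space. *)
Lemma point_filter_perp (x y : X) :
  perp (point_filter x) (point_filter y) <-> perp x y.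
Proof.
have oX := @cuvo_orthoframe I X.
split=> [[U Ux Uy]|xy]; first by apply: oX.2; exact: Uy.
have [_ [_ _ _ _ /(_ _ _ xy)[U [cU Ux Uy]]]] := @cuvo_UVO I X.
by exists (Cob _ cU).
Qed.

Lemma point_filter_cuvo_map : is_cuvo_map point_filter.
Proof.
split.
- apply: (spectral_basis (@phi_basis _ B)) => _ [U _ <-].
  exact: (cobP (U : cob X)).1.
- by move=> x y nxy /point_filter_perp.
- move=> y z; have [x <-] := point_filter_surj z => nxy.
  by exists x => // /point_filter_perp.
- move=> i U; rewrite S0_COBE => -[V _ <-]; rewrite rimage_phi.
  by rewrite !preimage_point_filter /= bicylE //; exact: cobP.
- by [].
Qed.

Definition point_filter_map : cuvo_map X (Cuvo (@S0_is_cuvo I B)) :=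
  @CuvoMap I X (Cuvo (@S0_is_cuvo I B)) point_filter point_filter_cuvo_map.

Lemma point_filter_inv : exists2 g : S0 B -> X,
  cancel point_filter g & cancel g point_filter.
Proof.
have /choice[g gK] := point_filter_surj.
by exists g => // x; apply: point_filter_inj; rewrite gK.
Qed.

End CuvoUnit.

(** * The unit on algebras *)

Section ColUnit.
Context {I : Type} (A : col I).

Let X : cuvo I := Cuvo (@S0_is_cuvo I A).

Lemma phi_COB (a : A) : COB (@perp I X) (phi a).
Proof.
by have -> : COB (@perp I X) = range (@phi _ A) := S0_COBE; exists a.
Qed.

Definition phi_cob (a : A) : A0 X := Cob _ (phi_COB a).

Lemma phi_cob_bij : bijective phi_cob.
Proof.
have surj (U : cob X) : exists a, phi_cob a = U.
  have := cobP U; rewrite S0_COBE => -[a _ aU]; exists a.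
  exact: cob_eq.
have /choice[g gK] := surj.
exists g => // a; apply: (@phi_inj _ A).
by have := congr1 (@cob_set I X) (gK (phi_cob a)).
Qed.

Lemma phi_cob_hom : is_col_hom phi_cob.
Proof.
split.
- split=> a b; apply: cob_eq => /=; [exact: phiI|exact: phi_join_bijoin].
- by split; apply: cob_eq; [exact: phi0|exact: phi1].
- by move=> a; apply: cob_eq; rewrite /= phi_orth.
- by move=> i a; apply: cob_eq; rewrite /= bicyl_phi.
- by move=> i k; exact: cob_eq.
Qed.

Definition phi_hom : col_hom A (Col (A0_is_col X)) :=
  @ColHom I A (Col (A0_is_col X)) phi_cob phi_cob_hom.

End ColUnit.

(** * The dual equivalence *)

Theorem theorem6p6 (I : Type) :
  exists (A0P : forall X : cuvo I, is_col (A0 X))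
         (A1P : forall (X Y : cuvo I) (f : cuvo_map X Y), is_col_hom (A1 f))
         (S0P : forall A : col I, is_cuvo (S0 A))
         (S1P : forall (A B : col I) (h : col_hom A B), is_cuvo_map (S1 h)),
    dual_equivalence (A_F A0P A1P) (S_F S0P S1P).
Proof.
exists (@A0_is_col I), (@A1_is_col_hom I), (@S0_is_cuvo I), (@S1_is_cuvo_map I).
split.
- by split=> [X|X Y Z g f]; apply: col_hom_eq => U; exact: cob_eq.
- by split=> [A|A B C h k]; apply: cuvo_map_eq => x; exact: lfilter_eq.
- exists (@point_filter_map I); split=> [X|X Y f].
    have [g fK gK] := point_filter_inv X.
    apply: (@cuvo_homeo_iso I X _ (point_filter_map X) g) => //.
      by move=> x y /point_filter_perp.
    move=> U cU; suff -> : g @^-1` U = phi (Cob _ cU : A0 X) by exact: phi_CO.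
    by apply/seteqP; split=> u; rewrite -[u]gK /= fK.
  by apply: cuvo_map_eq => x; exact: lfilter_eq.
- exists (@phi_hom I); split=> [A|A B h].
    exact/bijective_col_hom_iso/phi_cob_bij.
  by apply: col_hom_eq => a; exact: cob_eq.
Qed.
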